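(* Let $d\ge1$ and $1<r<2$. Then almost surely there exists $N>0$ such that for all $n\ge N$, $$|\lambda^{(n)}_k|<\tfrac12\qquad\text{for } k=2,\ldots,n.$$
   Context: Let $X_1,X_2,\ldots$ be i.i.d. uniformly distributed random points in $[-1,1]^d$, and let $\|x\|=\max_{1\le k\le d}|x_k|$ for $x\in\mathbb{R}^d$. For $r>0$ let $h_r(x,y)=1$ if $\|x-y\|\le r$ and $h_r(x,y)=0$ otherwise. Let $A_{n,r}$ be the $n\times n$ matrix with entries $(A_{n,r})_{i,j}=h_r(X_i,X_j)$ (including $i=j$), let $D_{n,r}=\mathrm{diag}(d_1,\ldots,d_n)$ with $d_i=\sum_{j=1}^n (A_{n,r})_{i,j}$, and let $W_{n,r}=D_{n,r}^{-1/2}A_{n,r}D_{n,r}^{-1/2}$. Let $\lambda^{(n)}_1\ge\lambda^{(n)}_2\ge\cdots\ge\lambda^{(n)}_n$ be the eigenvalues of $W_{n,r}$ counted with multiplicity. *)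

(* Defs.v *)
From HB Require Import structures.
From mathcomp Require Import all_boot all_order all_algebra finmap.
From mathcomp Require Import all_classical all_reals all_analysis.
From mathcomp Require Import complex.

Set Implicit Arguments.
Unset Strict Implicit.
Unset Printing Implicit Defensive.

Import Order.TTheory GRing.Theory Num.Theory.

Local Open Scope classical_set_scope.
Local Open Scope ring_scope.

Section uniform_cube.
Context {R : realType}.
Local Open Scope ereal_scope.

(* d-dimensional Lebesgue measure, as an iterated integral; it is only meant to
   be applied to measurable sets, for which Tonelli's theorem applies. *)
Fixpoint volume (d : nat) : set (d.-tuple R) -> \bar R :=
  match d return set (d.-tuple R) -> \bar R with
  | 0%N => fun B => \d_([tuple] : 0.-tuple R) B
  | d'.+1 => fun B =>
      \int[lebesgue_measure]_(x in [set: R])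
        volume [set t : d'.-tuple R | B [tuple of x :: t]]
  end.

Definition cube (d : nat) : set (d.-tuple R) :=
  [set x | forall k, (-1 <= tnth x k <= 1)%R].
Arguments cube : clear implicits.

(* The volume of [cube d] is 2 ^ d. *)
Definition uniform_on_cube disp (Omega : measurableType disp)
    (P : probability Omega R) d (X : {RV P >-> d.-tuple R}) : Prop :=
  forall B : set (d.-tuple R), measurable B ->
    distribution P X B = (2 ^- d)%:E * volume (B `&` cube d).

End uniform_cube.

Definition independent_RVs disp disp' (Omega : measurableType disp)
    (T : measurableType disp') (R : realType) (P : probability Omega R)
    (X : nat -> {RV P >-> T}) : Prop :=
  forall (J : {fset nat}) (B : nat -> set T), (forall i, measurable (B i)) ->
    P (\bigcap_(i in [set` J]) (X i @^-1` B i)) =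
    (\prod_(i <- J) P (X i @^-1` B i))%E.

Section geometric_graph.
Context {R : realType} (d : nat) (r : R).

Definition sup_dist (x y : d.-tuple R) : R :=
  \big[Num.max/0]_(k < d) `|tnth x k - tnth y k|.

Definition kernel_h (x y : d.-tuple R) : R :=
  if sup_dist x y <= r then 1 else 0.

Context (x : nat -> d.-tuple R) (n : nat).

Definition adjacency : 'M[R]_n := \matrix_(i, j) kernel_h (x i) (x j).

Definition degree (i : 'I_n) : R := \sum_j adjacency i j.

Definition inv_sqrt_degrees : 'M[R]_n :=
  diag_mx (\row_i (Num.sqrt (degree i))^-1).

Definition normalized_adjacency : 'M[R]_n :=
  inv_sqrt_degrees *m adjacency *m inv_sqrt_degrees.

End geometric_graph.

Section eigenvalues.
Context {R : realType}.

Definition ordered_spectrum n (M : 'M[R]_n) (s : n.-tuple R) : Prop :=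
  sorted >=%R s /\ char_poly M = \prod_(a <- s) ('X - a%:P).

(* Meaningful when the characteristic polynomial of M splits over R, e.g., for
   symmetric M: see eigenvaluesP. *)
Definition eigenvalues n (M : 'M[R]_n) : n.-tuple R :=
  xget [tuple of nseq n 0] [set s | ordered_spectrum M s].

End eigenvalues.

Lemma char_poly_conj (F : fieldType) n (Q A : 'M[F]_n) : Q \in unitmx ->
  char_poly (invmx Q *m A *m Q) = char_poly A.
Proof.
move=> Qu; rewrite /char_poly /char_poly_mx.
have QQ : map_mx polyC (invmx Q) *m map_mx polyC Q = 1%:M.
  by rewrite -map_mxM mulVmx// map_mx1.
have -> : 'X%:M - map_mx polyC (invmx Q *m A *m Q) =
    map_mx polyC (invmx Q) *m ('X%:M - map_mx polyC A) *m map_mx polyC Q.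
  by rewrite mulmxBr mulmxBl -!map_mxM scalar_mxC -[_%:M *m _ *m _]mulmxA QQ mulmx1.
by rewrite !det_mulmx mulrAC -det_mulmx QQ det1 mul1r.
Qed.

Lemma eigenvaluesP (R : realType) n (M : 'M[R]_n) :
  M^T = M -> ordered_spectrum M (eigenvalues M).
Proof.
move=> MT; suff [s Ms] : exists s, ordered_spectrum M s.
  by rewrite /eigenvalues; case: xgetP => [_ -> //|/(_ s)].
pose C : numClosedFieldType := R[i]%C.
pose f : {rmorphism R -> C} := real_complex R.
pose MC : 'M[C]_n := map_mx f M.
have MCh : MC \is hermsymmx.
  apply/is_hermitianmxP; rewrite expr0 scale1r; apply/matrixP => i j.
  rewrite !mxE -[M in LHS]MT mxE; apply/esym/CrealP.
  by apply/complex_realP; exists (M j i).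
pose D := spectral_diag MC.
have DR j : f (complex.Re (D 0 j)) = D 0 j.
  by apply: RRe_real; exact: (mxOverP (hermitian_spectral_diag_real MCh)).
pose s := sort >=%R [seq complex.Re (D 0 j) | j <- enum 'I_n].
have size_s : size s == n by rewrite size_sort size_map size_enum_ord.
exists (Tuple size_s); split; first by apply: sort_sorted => x y; exact: le_total.
apply: (map_poly_inj f); rewrite map_char_poly -/MC.
have /orthomx_spectralP -> := hermitian_normalmx MCh.
rewrite char_poly_conj ?spectral_unit// char_poly_trig ?diag_mx_is_trig//=.
rewrite (perm_big _ (permEl (perm_sort _ _)))/= big_map big_enum/= rmorph_prod/=.
by apply: eq_bigr => j _; rewrite map_polyXsubC DR !mxE eqxx mulr1n.
Qed.

Lemma normalized_adjacency_sym (R : realType) d (r : R)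
    (x : nat -> d.-tuple R) n :
  (normalized_adjacency r x n)^T = normalized_adjacency r x n.
Proof.
rewrite /normalized_adjacency !trmx_mul !tr_diag_mx mulmxA.
congr (_ *m _ *m _); apply/matrixP => i j; rewrite !mxE /kernel_h /sup_dist.
by under eq_bigr do rewrite distrC.
Qed.

(* Main.v *)
Require Import Defs.
From mathcomp Require Import all_boot all_order all_algebra finmap.
From mathcomp Require Import all_classical all_reals all_analysis.
From mathcomp Require Import complex.
From mathcomp Require Import zify ring lra.
Import Order.TTheory GRing.Theory Num.Theory.
Local Open Scope ring_scope.

(** The trace of an even power of [W] is the sum of the even powers of its
    eigenvalues, and the largest eigenvalue is at least [1].  Hence
    [|lambda_k|^(2m) <= \tr (W^(2m)) - 1] for [k >= 2], and it suffices to make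
    the right-hand side smaller than [(1/2)^(2m)] for a single [m].

    Cut the cube into [M^d] cells.  Almost surely (Chernoff and Borel-Cantelli)
    each cell eventually contains about [n / M^d] points, and then
    [\tr (W^(2m))] is at most a factor close to [1] times the corresponding
    trace for a walk on cells.  Since sup-norm balls are products of intervals,
    that trace is the [d]-th power of the trace of the [2m]-th power of the walk
    on [{0, ..., M-1}] that jumps uniformly to a site at distance at most about
    [r M / 2].

    Passing to discrete derivatives removes the eigenvalue [1] of this
    one-dimensional walk and leaves a nonnegative kernel [T], so the trace
    equals [1 + \tr (T^(2m))].  A row of [T] vanishes in the core, made of the
    sites adjacent to all others, and otherwise sums to [1/2], because only one
    end of the neighbourhood moves with its centre.  As [1 < r < 2], each of the
    latter rows puts mass bounded below on the core, where it is lost at the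
    next step; hence [\tr (T^(2m)) <= 2 b^(2m-1)] for some [b < 1/2] that does
    not depend on [M]. *)

(** * Powers of kernels *)

Section kpow.
Context {R : realFieldType}.
Implicit Types T : finType.

Fixpoint kpow T (K : T -> T -> R) (k : nat) (x y : T) : R :=
  if k is k'.+1 then \sum_z K x z * kpow T K k' z y else (x == y)%:R.
Arguments kpow {T}.

Lemma kpow1 T (K : T -> T -> R) x y : kpow K 1 x y = K x y.
Proof.
rewrite /= (bigD1 y)//= eqxx mulr1 big1 ?addr0// => z /negPf ->.
by rewrite mulr0.
Qed.

Lemma kpow_ge0 T (K : T -> T -> R) : (forall x y, 0 <= K x y) ->
  forall k x y, 0 <= kpow K k x y.
Proof.
move=> K0; elim=> [|k IH] x y /=; first exact: ler0n.
by apply: sumr_ge0 => z _; rewrite mulr_ge0.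
Qed.

Lemma kpow_le T (K L : T -> T -> R) (t : R) : 0 <= t ->
  (forall x y, 0 <= K x y <= t * L x y) ->
  forall k x y, kpow K k x y <= t ^+ k * kpow L k x y.
Proof.
move=> t0 KL; elim=> [|k IH] x y /=; first by rewrite mul1r.
rewrite exprS -mulrA mulr_sumr mulr_sumr; apply: ler_sum => z _.
have /andP[K0 KLxz] := KL x z.
have -> : t * (t ^+ k * (L x z * kpow L k z y)) =
  (t * L x z) * (t ^+ k * kpow L k z y) by ring.
apply: ler_pM => //; apply: kpow_ge0 => a b; by case/andP: (KL a b).
Qed.

Lemma mx_kpow n (A : 'M[R]_n) k i j : (A ^+ k) i j = kpow A k i j.
Proof.
elim: k i j => [|k IH] i j; first by rewrite expr0 mxE.
by rewrite exprS mxE; apply: eq_bigr => l _; rewrite IH.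
Qed.

(** Coordinates move independently: a product summed over all intermediate functions factors into
    coordinatewise sums. *)
Lemma kpow_prod (I T : finType) (K : T -> T -> R) k (x y : {ffun I -> T}) :
  kpow (fun a b : {ffun I -> T} => \prod_i K (a i) (b i)) k x y =
  \prod_i kpow K k (x i) (y i).
Proof.
elim: k x y => [|k IH] x y /=.
  have [->|nxy] := eqVneq x y; first by rewrite big1// => i _; rewrite eqxx.
  have /existsP[i ni] : [exists i, x i != y i].
    rewrite -negb_forall; apply: contra nxy => /forallP h.
    by apply/eqP/ffunP => i; apply/eqP.
  by rewrite (bigD1 i)//= (negPf ni) mul0r.
rewrite bigA_distr_bigA /=; apply: eq_bigr => z _.
by rewrite IH big_split.
Qed.

Lemma trace_kpow_prod (I T : finType) (K : T -> T -> R) k :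
  \sum_x kpow (fun a b : {ffun I -> T} => \prod_i K (a i) (b i)) k x x =
  (\sum_x kpow K k x x) ^+ #|I|.
Proof.
under eq_bigr do rewrite kpow_prod.
by rewrite -(bigA_distr_bigA (fun _ x => kpow K k x x)) prodr_const.
Qed.

(** A contributing path has only active intermediate sites, because inactive rows vanish. So each of
    the first [k] steps carries mass at most [b], and the last one weighs at most [B]. *)
Lemma kpow_active_le T (K : T -> T -> R) (act : pred T) (b B : R) :
  0 <= B -> 0 <= b ->
  (forall x y, 0 <= K x y <= B) -> (forall x y, ~~ act x -> K x y = 0) ->
  (forall x, \sum_(y | act y) K x y <= b) ->
  forall k x y, kpow K k.+1 x y <= b ^+ k * B.
Proof.
move=> B0 b0 KB Kact Kb; elim=> [|k IH] x y.
  by rewrite kpow1 mul1r; case/andP: (KB x y).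
have K0 u v : 0 <= K u v by case/andP: (KB u v).
rewrite [kpow _ _ _ _]/= (bigID act) /= [X in _ + X]big1 ?addr0; last first.
  by move=> z nz; rewrite big1 ?mulr0// => u _; rewrite Kact ?mul0r.
apply: (@le_trans _ _ (\sum_(z | act z) K x z * (b ^+ k * B))).
  by apply: ler_sum => z _; rewrite ler_wpM2l//; exact: IH.
by rewrite -mulr_suml exprS -mulrA ler_wpM2r// mulr_ge0// exprn_ge0.
Qed.

(** Each of the [k + 1] steps costs a factor [u], and each of the [k] intermediate points is summed
    over a fibre of [f] with at most [v] elements. *)
Lemma kpow_coarse_le (S T : finType) (f : S -> T) (K : S -> S -> R)
    (L : T -> T -> R) (u v : R) : 0 <= u -> 0 <= v ->
  (forall x y, 0 <= L x y) ->
  (forall x y, 0 <= K x y <= u * L (f x) (f y)) ->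
  (forall c, #|[pred x | f x == c]|%:R <= v) ->
  forall k x y, kpow K k.+1 x y <= u * (u * v) ^+ k * kpow L k.+1 (f x) (f y).
Proof.
move=> u0 v0 L0 KL cnt; elim=> [|k IH] x y.
  by rewrite !kpow1 mulr1; case/andP: (KL x y).
have K0 a b : 0 <= K a b by case/andP: (KL a b).
rewrite [kpow K _ _ _]/= [kpow L _ _ _]/=.
apply: (@le_trans _ _ (\sum_z (u * L (f x) (f z)) *
    (u * (u * v) ^+ k * kpow L k.+1 (f z) (f y)))).
  apply: ler_sum => z _; apply: ler_pM => //; last exact: IH.
    by apply: (kpow_ge0 _ _ K0 k.+1).
  by case/andP: (KL x z).
rewrite (partition_big f predT)//= mulr_sumr; apply: ler_sum => c _.
have -> : \sum_(i | f i == c) u * L (f x) (f i) * (u * (u * v) ^+ k * kpow L k.+1 (f i)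
  (f y))
  = \sum_(i | f i == c) u * L (f x) c * (u * (u * v) ^+ k * kpow L k.+1 c (f y)).
  by apply: eq_bigr => i /eqP ->.
rewrite sumr_const -mulr_natl exprS.
have -> : u * (u * v * (u * v) ^+ k) * (L (f x) c * kpow L k.+1 c (f y)) =
  v * (u * L (f x) c * (u * (u * v) ^+ k * kpow L k.+1 c (f y))) by ring.
apply: ler_wpM2r; last exact: cnt.
by rewrite !mulr_ge0 ?exprn_ge0 ?mulr_ge0//; apply: kpow_ge0.
Qed.

(** Compared with a single entry, summing over the common endpoint of closed paths costs one more
    factor [v]. *)
Lemma trace_kpow_coarse_le (S T : finType) (f : S -> T) (K : S -> S -> R)
    (L : T -> T -> R) (u v : R) : 0 <= u -> 0 <= v ->
  (forall x y, 0 <= L x y) ->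
  (forall x y, 0 <= K x y <= u * L (f x) (f y)) ->
  (forall c, #|[pred x | f x == c]|%:R <= v) ->
  forall k, \sum_x kpow K k.+1 x x <= (u * v) ^+ k.+1 * \sum_c kpow L k.+1 c c.
Proof.
move=> u0 v0 L0 KL cnt k.
apply: (@le_trans _ _ (\sum_x u * (u * v) ^+ k * kpow L k.+1 (f x) (f x))).
  by apply: ler_sum => x _; apply: kpow_coarse_le.
rewrite (partition_big f predT)//= mulr_sumr; apply: ler_sum => c _.
have -> : \sum_(i | f i == c) u * (u * v) ^+ k * kpow L k.+1 (f i) (f i)
  = \sum_(i | f i == c) u * (u * v) ^+ k * kpow L k.+1 c c.
  by apply: eq_bigr => i /eqP ->.
rewrite sumr_const -mulr_natl exprS.
have -> : u * v * (u * v) ^+ k * kpow L k.+1 c c =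
  v * (u * (u * v) ^+ k * kpow L k.+1 c c) by ring.
apply: ler_wpM2r; last exact: cnt.
by rewrite !mulr_ge0 ?exprn_ge0 ?mulr_ge0//; apply: kpow_ge0.
Qed.

End kpow.
Arguments kpow {R T}.

(** * The walk on an interval *)

Lemma card_ord_itv n lo hi :
  #|[pred b : 'I_n | (lo <= b < hi)%N]| = (minn hi n - lo)%N.
Proof.
rewrite -sum1_card big_mkcond /=.
elim: n => [|n IH]; first by rewrite big_ord0; lia.
by rewrite big_ord_recr /= IH inE /=; case: ifP; lia.
Qed.

(** Doubled triangular number, which keeps the later row sums in [nat]. *)
Lemma sum_succ_cut n l :
  (2 * (\sum_(e < n) if (e < l)%N then e.+1 else 0) = minn l n * (minn l n).+1)%N.
Proof.
elim: n => [|n IH]; first by rewrite big_ord0; lia.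
by rewrite big_ord_recr /= mulnDr IH; case: ifP; nia.
Qed.

Section difference.
Context {R : realFieldType} (L : nat).
Implicit Types P : 'I_L.+1 -> 'I_L.+1 -> R.

(* [diff_kernel P] is the action of [P] on discrete derivatives:
   if [D f c = f (c + 1) - f c], then [D (P f) = diff_kernel P (D f)]
   whenever [P] fixes constants. *)
Definition diff_kernel P (c e : 'I_L) : R :=
  \sum_b (P (lift ord0 c) b - P (widen_ord (leqnSn L) c) b) * (e < b)%:R.

(** With [D] the difference operator, [J] summation from the left end and [C] the map from [f] to
    the constant [f 0], one has [1 = J D + C]. As [P] fixes constants and [D] kills them,
    [D P = T D] for [T = D P J]. Cyclicity of the trace then yields the power of [T], while
    [P^(k+1) C = C] contributes [1]. *)
Lemma trace_diff_kernel P k : (forall a, \sum_b P a b = 1) ->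
  \sum_a kpow P k.+1 a a = 1 + \sum_c kpow (diff_kernel P) k.+1 c c.
Proof.
move=> P1.
pose Pm : 'M[R]_L.+1 := \matrix_(a, b) P a b.
pose D : 'M[R]_(L, L.+1) :=
  \matrix_(c, b) ((b == lift ord0 c)%:R - (b == widen_ord (leqnSn L) c)%:R).
pose J : 'M[R]_(L.+1, L) := \matrix_(b, e) (e < b)%:R.
pose C : 'M[R]_L.+1 := const_mx 1 *m delta_mx (0 : 'I_1) 0.
pose T : 'M[R]_L := \matrix_(c, e) diff_kernel P c e.
have trP : \tr (Pm ^+ k.+1) = \sum_a kpow P k.+1 a a.
  apply: eq_bigr => a _; rewrite mx_kpow.
  have E : forall j x y, kpow Pm j x y = kpow P j x y.
    by elim=> //= j IH x y; apply: eq_bigr => z _; rewrite mxE IH.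
  exact: E.
have trT : \tr (T ^+ k.+1) = \sum_c kpow (diff_kernel P) k.+1 c c.
  apply: eq_bigr => a _; rewrite mx_kpow.
  have E : forall j x y, kpow T j x y = kpow (diff_kernel P) j x y.
    by elim=> //= j IH x y; apply: eq_bigr => z _; rewrite mxE IH.
  exact: E.
have DE p (A : 'M[R]_(L.+1, p)) c b : (D *m A) c b =
    A (lift ord0 c) b - A (widen_ord (leqnSn L) c) b.
  rewrite mxE; under eq_bigr do rewrite mxE mulrBl.
  rewrite sumrB (bigD1 (lift ord0 c))//= eqxx mul1r big1 ?addr0; last first.
    by move=> i /negPf ->; rewrite mul0r.
  rewrite (bigD1 (widen_ord (leqnSn L) c))//= eqxx mul1r big1 ?addr0//.
  by move=> i /negPf ->; rewrite mul0r.
have TE : T = D *m Pm *m J.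
  by apply/matrixP => c e; rewrite !mxE; apply: eq_bigr => b _; rewrite DE !mxE.
have JD : 1%:M = J *m D + C.
  apply/matrixP => b b'; rewrite !mxE.
  under eq_bigr do rewrite !mxE.
  rewrite big_ord1 !mxE eqxx mul1r /=.
  pose g (i : nat) : R := (b' == i :> nat)%:R.
  have -> : \sum_(c < L) ((c < b)%:R *
      ((b' == lift ord0 c)%:R - (b' == widen_ord (leqnSn L) c)%:R)) =
      \sum_(c < L | (c < b)%N) (g c.+1 - g c).
    rewrite [RHS]big_mkcond; apply: eq_bigr => c _ /=.
    rewrite -[b' == lift _ _]val_eqE -[b' == widen_ord _ _]val_eqE /= /bump leq0n add1n.
    by case: ifP; rewrite ?mul1r ?mul0r.
  rewrite -(big_ord_widen _ (fun c => g c.+1 - g c)) -1?ltnS//.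
  by rewrite -(big_mkord predT (fun c => g c.+1 - g c)) telescope_sumr// /g -val_eqE
    eq_sym subrK.
have PC : Pm *m (const_mx 1 : 'M[R]_(L.+1, 1)) = const_mx 1.
  apply/matrixP => a b; rewrite [RHS]mxE -[RHS](P1 a) mxE.
  by apply: eq_bigr => i _; rewrite !mxE mulr1.
have PkC j : Pm ^+ j *m (const_mx 1 : 'M[R]_(L.+1, 1)) = const_mx 1.
  by elim: j => [|j IH]; rewrite ?expr0 ?mul1mx// exprSr -mulmxA PC.
have DC : D *m (const_mx 1 : 'M[R]_(L.+1, 1)) = 0.
  by apply/matrixP => a b; rewrite DE !mxE subrr.
have DP : D *m Pm = T *m D.
  rewrite TE -mulmxA -[LHS]mulmx1 JD mulmxDr !mulmxA addrC.
  by rewrite -[_ *m Pm *m const_mx 1]mulmxA PC DC mul0mx add0r.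
have DPk j : D *m Pm ^+ j.+1 *m J = T ^+ j.+1.
  elim: j => [|j IH]; first by rewrite !expr1 -TE.
  by rewrite exprS mulmxA DP -!mulmxA [X in T *m X]mulmxA IH [RHS]exprS.
rewrite -trP -[Pm ^+ k.+1]mulmx1 JD mulmxDr mxtraceD addrC mulmxA; congr (_ + _).
  rewrite mulmxA PkC mxtrace_mulC /mxtrace big_ord1 mxE (bigD1 0)//= big1 ?addr0.
    by rewrite !mxE mulr1.
  by move=> i /negPf n0; rewrite !mxE n0 andbF mul0r.
by rewrite mxtrace_mulC mulmxA DPk.
Qed.

End difference.

Section interval_walk.
Context {R : realFieldType}.

Definition near_nat (rho a b : nat) := (a <= b + rho)%N && (b <= a + rho)%N.

Definition near_deg n (rho : nat) (a : 'I_n) : nat :=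
  #|[pred b : 'I_n | near_nat rho a b]|.

Definition walk n (rho : nat) (a b : 'I_n) : R :=
  (near_nat rho a b)%:R / (near_deg n rho a)%:R.

Lemma near_degE n rho (a : 'I_n) :
  near_deg n rho a = (minn (a + rho).+1 n - (a - rho))%N.
Proof.
rewrite /near_deg -card_ord_itv; apply: eq_card => b.
by rewrite !inE /near_nat; lia.
Qed.

Lemma near_deg_gt0 n rho (a : 'I_n) : (0 < near_deg n rho a)%N.
Proof. by rewrite near_degE; have := ltn_ord a; lia. Qed.

Lemma sum_near n rho (a : 'I_n) :
  \sum_(b < n) (near_nat rho a b)%:R = (near_deg n rho a)%:R :> R.
Proof. by rewrite -natr_sum -big_mkcond sum1_card. Qed.

Lemma walk_sum1 n rho (a : 'I_n) : \sum_b walk n rho a b = 1.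
Proof.
rewrite -mulr_suml sum_near divff// pnatr_eq0 -lt0n; exact: near_deg_gt0.
Qed.

Lemma walk_tail n rho (a : 'I_n) (e : nat) :
  \sum_b walk n rho a b * (e < b)%:R =
  (minn (a + rho).+1 n - maxn (a - rho) e.+1)%:R / (near_deg n rho a)%:R.
Proof.
rewrite -card_ord_itv -sum1_card natr_sum [X in _ = X * _]big_mkcond mulr_suml /=.
apply: eq_bigr => b _; rewrite inE mulrAC -natrM mulnb; congr (_ / _).
have -> : near_nat rho a b && (e < b)%N =
    (maxn (a - rho) e.+1 <= b < (a + rho).+1)%N by have := ltn_ord b; rewrite /near_nat;
      lia.
by case: (_ <= b < _)%N.
Qed.

(** In the core, both [c] and [c + 1] see the whole interval. Otherwise [L < 2 * rho] keeps one end
    of the neighbourhood clipped while the other moves by one site; [l] is then the size of the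
    smaller neighbourhood, the larger having [l + 1] sites. *)
Lemma diff_walkE L rho (c e : 'I_L) : (L < 2 * rho)%N -> (rho <= L)%N ->
  let l := if (rho <= c)%N then (L - (c - rho))%N else (c + rho).+1 in
  let w := if (rho <= c)%N then if (c - rho <= e)%N then (L - e)%N else 0%N
           else if (e <= c + rho)%N then e.+1 else 0%N in
  diff_kernel L (walk L.+1 rho) c e =
    if (L - rho <= c < rho)%N then 0 else w%:R / (l%:R * l.+1%:R) :> R.
Proof.
move=> Lr rL l w; rewrite /diff_kernel.
under eq_bigr do rewrite mulrBl.
rewrite sumrB !walk_tail !near_degE /=.
have cL := ltn_ord c; have eL := ltn_ord e.
have -> : bump 0 c = c.+1 by rewrite /bump leq0n add1n.
case: ifP => [core|ncore].
  apply/eqP; rewrite subr_eq0; apply/eqP; congr (_%:R / _%:R); lia.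
have l0 : (0 < l)%N by rewrite /l; case: ifP; lia.
have lR : l%:R != 0 :> R by rewrite pnatr_eq0 -lt0n.
have lR1 : 1 + l%:R != 0 :> R by rewrite nat1r pnatr_eq0.
rewrite {}/w; case: ifP => rc; rewrite rc in l l0 lR lR1 *.
- have -> : (minn (c.+1 + rho).+1 L.+1 - (c.+1 - rho))%N = l by rewrite /l; lia.
  have -> : (minn (c + rho).+1 L.+1 - (c - rho))%N = l.+1 by rewrite /l; lia.
  case: ifP => ce.
    have -> : (minn (c.+1 + rho).+1 L.+1 - maxn (c.+1 - rho) e.+1)%N = (L - e)%N by lia.
    have -> : (minn (c + rho).+1 L.+1 - maxn (c - rho) e.+1)%N = (L - e)%N by lia.
    by rewrite -nat1r; field; rewrite lR lR1.
  have -> : (minn (c.+1 + rho).+1 L.+1 - maxn (c.+1 - rho) e.+1)%N = l by rewrite /l; lia.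
  have -> : (minn (c + rho).+1 L.+1 - maxn (c - rho) e.+1)%N = l.+1 by rewrite /l; lia.
  by rewrite mul0r -nat1r !divff// subrr.
- have -> : (minn (c.+1 + rho).+1 L.+1 - (c.+1 - rho))%N = l.+1 by rewrite /l; lia.
  have -> : (minn (c + rho).+1 L.+1 - (c - rho))%N = l by rewrite /l; lia.
  case: ifP => ce.
    have -> : (minn (c.+1 + rho).+1 L.+1 - maxn (c.+1 - rho) e.+1)%N = (l - e)%N
      by rewrite /l; lia.
    have -> : (minn (c + rho).+1 L.+1 - maxn (c - rho) e.+1)%N = (l - e.+1)%N
      by rewrite /l; lia.
    have el : (e < l)%N by rewrite /l; lia.
    clearbody l; rewrite !natrB//; last exact: ltnW.
    by rewrite -!nat1r; field; rewrite lR lR1.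
  have -> : (minn (c.+1 + rho).+1 L.+1 - maxn (c.+1 - rho) e.+1)%N = 0%N by lia.
  have -> : (minn (c + rho).+1 L.+1 - maxn (c - rho) e.+1)%N = 0%N by lia.
  by rewrite !mul0r subr0.
Qed.

Lemma trace_walk_le L rho (b : R) : (L < 2 * rho)%N -> (rho <= L)%N -> 0 <= b ->
  1 / 2 - ((2 * rho - L) * (L - rho).+1)%:R / (L * L.+1)%:R <= b ->
  forall k, \sum_a kpow (walk L.+1 rho) k.+1 a a <= 1 + 2 * b ^+ k.
Proof.
move=> Lr rL b0 hb k.
rewrite trace_diff_kernel; last exact: walk_sum1.
rewrite lerD2l.
pose core := [pred e : 'I_L | (L - rho <= e < rho)%N].
(* There are [L] diagonal entries, each at most [b ^ k / (rho + 1)], and [L < 2 * rho] gives the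
   factor [2]. *)
apply: (@le_trans _ _ (\sum_(c < L) b ^+ k * (rho.+1%:R)^-1)); last first.
  rewrite sumr_const card_ord -[X in X <= _]mulr_natr -mulrA mulrC ler_wpM2r ?exprn_ge0//.
  rewrite ler_pdivrMl ?ltr0n// -natrM ler_nat; lia.
have rho0 : 0 <= (rho.+1%:R)^-1 :> R by rewrite invr_ge0 ler0n.
apply: ler_sum => c0 _; apply: (@kpow_active_le _ _ _ [predC core]) => //.
- move=> c e; rewrite diff_walkE//; case: ifP => cc; first by apply/andP; split;
    rewrite ?invr_ge0 ?ler0n.
  rewrite divr_ge0 ?ler0n//= ?mulr_ge0 ?ler0n//.
  have cL := ltn_ord c; have eL := ltn_ord e.
  rewrite ler_pdivrMr -?natrM ?ltr0n; last by rewrite muln_gt0; case: ifP; lia.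
  rewrite ler_pdivlMl ?ltr0n// -natrM ler_nat mulnC.
  by apply: leq_mul; case: (rho <= c)%N => //; try case: ifP; lia.
- move=> c e; rewrite negbK => cc; rewrite diff_walkE//; move: cc; rewrite inE => cc.
  by rewrite cc.
- move=> c; have [cc|cc] := boolP (c \in core).
    rewrite big1// => e _; rewrite diff_walkE//; move: cc; rewrite inE /= => ->.
    by [].
  apply: le_trans hb; rewrite inE /= in cc.
  pose l := if (rho <= c)%N then (L - (c - rho))%N else (c + rho).+1.
  pose w (e : 'I_L) := if (rho <= c)%N then if (c - rho <= e)%N then (L - e)%N else 0%N
    else if (e <= c + rho)%N then e.+1 else 0%N.
  under eq_bigr => e do rewrite diff_walkE// (negPf cc) -/l -/(w e).
  rewrite -mulr_suml -natr_sum /=.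
  have cL := ltn_ord c.
  have lL : (0 < l <= L)%N by rewrite /l; case: ifP; lia.
  have W : (2 * \sum_(e < L) w e = l * l.+1)%N.
    rewrite -(minn_idPl (proj2 (andP lL))) -sum_succ_cut; congr (2 * _)%N.
    rewrite /w /l; case: ifP => rc.
      (* Reversal exchanges the two ends and reduces a moving left end to a moving right end. *)
      rewrite (reindex_inj rev_ord_inj); apply: eq_bigr => e _ /=.
      have := ltn_ord e; case: ifP; case: ifP; lia.
    by apply: eq_bigr => e _; rewrite ltnS.
  (* Each of the [2 * rho - L] core sites has weight at least [L - rho + 1]; normalized, this is the
     mass taken away from the row sum [1 / 2]. *)
  have core_ge : ((2 * rho - L) * (L - rho).+1 <= \sum_(e in core) w e)%N.
    have <- : (#|core| = 2 * rho - L)%N by rewrite /core card_ord_itv; lia.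
    rewrite -sum_nat_const; apply: leq_sum => e; rewrite inE /= /w => ce.
    by case: ifP => ?; case: ifP; lia.
  have LL0 : (0 < L * L.+1)%N by rewrite muln_gt0; lia.
  have ll0 : (0 < l * l.+1)%N by rewrite muln_gt0; lia.
  move: W; rewrite (bigID (mem core)) /= => W.
  set S := \sum_(e < L | e \notin core) w e in W *.
  set Q := \sum_(e < L | e \in core) w e in W core_ge.
  rewrite -natrM ler_pdivrMr ?ltr0n// mulrBl.
  apply: (@le_trans _ _ ((l * l.+1)%:R / 2 - Q%:R)).
    by rewrite -W natrM natrD; lra.
  rewrite mul1r mulrC lerD2l lerN2 mulrAC ler_pdivrMr ?ltr0n// -!natrM ler_nat.
  by apply: leq_mul => //; apply: leq_mul; lia.
Qed.
End interval_walk.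

(** * Discretization *)

Lemma near_deg_succ_le n g (x : 'I_n) :
  (near_deg n g.+1 x <= near_deg n g.-1 x + 4)%N.
Proof. by rewrite !near_degE; have := ltn_ord x; lia. Qed.

Lemma near_deg_pred_ge n g (x : 'I_n) : (g <= n)%N ->
  (g <= near_deg n g.-1 x)%N.
Proof. by rewrite !near_degE; have := ltn_ord x; lia. Qed.

Section grid.
Context {R : archiRealFieldType} (r : R).

(** Cells have length [2 / n] and are half-open: [x = 1] would get the index [n], out of range. *)
Definition cell n (x : R) : nat := Num.trunc ((x + 1) / 2 * n%:R).

Definition grid_radius n : nat := Num.trunc (r / 2 * n%:R).

(* Up to normalization by the number of points per cell, a majorant of the
   transition probabilities of the geometric graph: points at distance at most
   [r] lie in cells at distance at most [grid_radius n + 1], and, when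
   [grid_radius n] is positive, cells at distance at most [grid_radius n - 1]
   contain only points at distance at most [r]. *)
Definition grid_walk n (a b : 'I_n) : R :=
  (near_nat (grid_radius n).+1 a b)%:R / (near_deg n (grid_radius n).-1 a)%:R.

Lemma grid_walk_ge0 n (a b : 'I_n) : 0 <= grid_walk n a b.
Proof. by rewrite divr_ge0. Qed.

Lemma cell_itv n x : -1 <= x ->
  (cell n x)%:R <= (x + 1) / 2 * n%:R < (cell n x).+1%:R.
Proof.
by move=> x1; apply: truncn_itv; rewrite mulr_ge0// divr_ge0//; lra.
Qed.

Lemma cell_lt n x : (0 < n)%N -> -1 <= x < 1 -> (cell n x < n)%N.
Proof.
move=> n0 /andP[x1 x2]; have /andP[h _] := cell_itv n x x1.
rewrite -(ltr_nat R); apply: le_lt_trans h _.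
by rewrite gtr_pMl ?ltr0n//; lra.
Qed.

Lemma grid_radius_itv n : 0 <= r ->
  (grid_radius n)%:R <= r / 2 * n%:R < (grid_radius n).+1%:R.
Proof. by move=> r0; apply: truncn_itv; rewrite mulr_ge0// divr_ge0. Qed.

Lemma near_cell n x y : 0 <= r -> -1 <= x -> -1 <= y -> `|x - y| <= r ->
  near_nat (grid_radius n).+1 (cell n x) (cell n y).
Proof.
move=> r0 /(cell_itv n)/andP[x1 x2] /(cell_itv n)/andP[y1 y2].
have /andP[_ h] := grid_radius_itv n r0.
rewrite ler_norml => /andP[xy1 xy2].
have n0 : 0 <= n%:R / 2 :> R by rewrite divr_ge0.
have a1 := ler_wpM2r n0 xy1; have a2 := ler_wpM2r n0 xy2.
rewrite -[(cell n x).+1%:R]natr1 in x2; rewrite -[(cell n y).+1%:R]natr1 in y2;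
  rewrite -[(grid_radius n).+1%:R]natr1 in h.
by apply/andP; split; rewrite -ltnS -(ltr_nat R) -natr1 natrD
  -[(grid_radius n).+1%:R]natr1; lra.
Qed.

Lemma cell_near n x y : (0 < n)%N -> 0 <= r -> (0 < grid_radius n)%N ->
  -1 <= x -> -1 <= y ->
  near_nat (grid_radius n).-1 (cell n x) (cell n y) -> `|x - y| <= r.
Proof.
move=> n0 r0 g0 /(cell_itv n)/andP[x1 x2] /(cell_itv n)/andP[y1 y2].
have /andP[h _] := grid_radius_itv n r0.
have n0' : 0 < n%:R / 2 :> R by rewrite divr_gt0// ltr0n.
rewrite -(prednK g0) -[_.-1.+1%:R]natr1 in h.
rewrite -[(cell n x).+1%:R]natr1 in x2; rewrite -[(cell n y).+1%:R]natr1 in y2.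
rewrite /near_nat -!(ler_nat R) !natrD => /andP[xy yx].
by rewrite ler_norml; apply/andP; split; rewrite -(ler_pM2r n0'); lra.
Qed.

(** On a fine grid [grid_walk] is at most [t] times the genuine walk of radius [grid_radius + 1],
    for which the core mass in [trace_walk_le] tends to [(r - 1) * (2 - r) / 2]. Giving up half of
    this limit absorbs the rounding. *)
Lemma trace_grid_walk_le (t : R) : 1 < r < 2 -> 1 < t ->
  exists L, (0 < grid_radius L.+1)%N /\
    forall k, \sum_a kpow (grid_walk L.+1) k.+1 a a <=
      t ^+ k.+1 * (1 + 2 * (1 / 2 - (r - 1) * (2 - r) / 4) ^+ k).
Proof.
move=> /andP[r1 r2] t1.
have r0 : 0 <= r by lra.
have u0 : 0 < (2 - r)^-1 by rewrite invr_gt0; lra.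
have v0 : 0 < (t - 1)^-1 by rewrite invr_gt0; lra.
(* With [g] the grid radius, the first term secures [(L + 1) - (g + 1) >= (L + 1) * (2 - r) / 4],
   and the second makes [4 / g < t - 1]. *)
pose L := Num.trunc (4 / (2 - r) + 8 / (t - 1) + 4); exists L.
have := truncnS_gt (4 / (2 - r) + 8 / (t - 1) + 4); rewrite -/L => LL.
have L1 : 4 <= L.+1%:R * (2 - r).
  rewrite -ler_pdivrMr; last by lra.
  have : 0 <= 8 / (t - 1) by rewrite mulr_ge0 ?ltW.
  by lra.
have L2 : 8 / (t - 1) + 4 <= L.+1%:R.
  have : 0 <= 4 / (2 - r) by rewrite mulr_ge0 ?ltW.
  by lra.
have L4 : 4 <= L.+1%:R :> R.
  have : 0 <= 8 / (t - 1) by rewrite mulr_ge0 ?ltW.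
  by lra.
have /andP[g1 g2] := grid_radius_itv L.+1 r0.
set g := grid_radius L.+1 in g1 g2 *.
have gL : L.+1%:R < 2 * g.+1%:R :> R.
  have : 1 * L.+1%:R <= r * L.+1%:R by rewrite ler_wpM2r// ltW.
  by lra.
have g3 : 4 / (t - 1) < g%:R by rewrite -[g.+1%:R]natr1 in gL; lra.
have g0 : (0 < g)%N.
  by rewrite -(ltr_nat R); apply: lt_trans g3; rewrite divr_gt0//; lra.
split=> // k.
have rL : (g.+1 <= L)%N.
  by rewrite -ltnS -(ler_nat R) -[_.+2%:R]natr1 -[g.+1%:R]natr1; lra.
have Lr : (L < 2 * g.+1)%N.
  by apply: ltnW; rewrite -(ltr_nat R) natrM.
have t0 : 0 <= t by lra.
apply: (@le_trans _ _ (t ^+ k.+1 * \sum_a kpow (walk L.+1 g.+1) k.+1 a a)).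
  rewrite mulr_sumr; apply: ler_sum => a _; apply: kpow_le => // x y.
  rewrite grid_walk_ge0 /grid_walk /walk -/g /= mulrCA ler_wpM2l ?ler0n//.
  have p0 : 0 < (near_deg L.+1 g.-1 x)%:R :> R by rewrite ltr0n near_deg_gt0.
  have q0 : 0 < (near_deg L.+1 g.+1 x)%:R :> R by rewrite ltr0n near_deg_gt0.
  rewrite ler_pdivlMr// mulrC ler_pdivrMr//.
  (* At most two more sites at each end, against at least [g] sites: the degrees differ by a factor
     at most [1 + 4 / g], hence at most [t]. *)
  have pq : (near_deg L.+1 g.+1 x <= near_deg L.+1 g.-1 x + 4)%N.
    exact: near_deg_succ_le.
  have gp : (g <= near_deg L.+1 g.-1 x)%N.
    by apply: near_deg_pred_ge; exact: leq_trans (leqnSn _) (leq_trans rL (leqnSn L)).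
  rewrite -(ler_nat R) natrD in pq; rewrite -(ler_nat R) in gp.
  have : 4 <= (t - 1) * g%:R by rewrite mulrC -ler_pdivrMr; lra.
  have : (t - 1) * g%:R <= (t - 1) * (near_deg L.+1 g.-1 x)%:R by rewrite ler_wpM2l//; lra.
  by lra.
rewrite ler_wpM2l ?exprn_ge0//; apply: trace_walk_le => //.
  have : (r - 1) * (2 - r) <= 1 * 1 by apply: ler_pM; lra.
  by lra.
rewrite lerD2l lerN2 ler_pdivlMr; last first.
  by rewrite ltr0n muln_gt0 (leq_trans _ rL).
rewrite -subSS -(subSn rL) !natrM natrB; last exact: ltnW.
rewrite natrB; last exact: leqW.
have a1 : L.+1%:R * (r - 1) <= (2 * g.+1).+1%:R - L.+1%:R.
  by rewrite -[_.+1%:R in X in _ <= X]natr1 natrM; lra.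
have a2 : L.+1%:R * (2 - r) / 4 <= L.+1%:R - g.+1%:R.
  by rewrite -[g.+1%:R]natr1; lra.
have LL' : L%:R <= L.+1%:R :> R by rewrite ler_nat.
apply: (@le_trans _ _ ((L.+1%:R * (r - 1)) * (L.+1%:R * (2 - r) / 4))).
  have -> : L.+1%:R * (r - 1) * (L.+1%:R * (2 - r) / 4) =
    (r - 1) * (2 - r) / 4 * (L.+1%:R * L.+1%:R) by ring.
  rewrite ler_wpM2l ?ler_wpM2r//.
  by rewrite divr_ge0// mulr_ge0//; lra.
by apply: ler_pM => //; rewrite !mulr_ge0//; lra.
Qed.

End grid.

(** * Spectrum and traces *)

(** Unitary diagonalization over [R[i]] reduces matrix powers to powers of the diagonal; comparing
    characteristic polynomials shows that this diagonal is a permutation of [s]. *)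
Lemma trace_exp_spectrum (R : realType) n (M : 'M[R]_n) (s : n.-tuple R) k :
  M^T = M -> ordered_spectrum M s -> \tr (M ^+ k) = \sum_(a <- s) a ^+ k.
Proof.
move=> MT [_ Ms].
pose C : numClosedFieldType := R[i]%C.
pose f : {rmorphism R -> C} := real_complex R.
pose MC : 'M[C]_n := map_mx f M.
have MCh : MC \is hermsymmx.
  apply/is_hermitianmxP; rewrite expr0 scale1r; apply/matrixP => i j.
  rewrite !mxE -[M in LHS]MT mxE; apply/esym/CrealP.
  by apply/complex_realP; exists (M j i).
have /orthomx_spectralP := hermitian_normalmx MCh.
set Q := spectralmx MC; set D := spectral_diag MC => MCE.
have Qu : Q \in unitmx by exact: spectral_unit.
have MCk j : MC ^+ j = invmx Q *m diag_mx (\row_i D 0 i ^+ j) *m Q.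
  elim: j => [|j IH].
    rewrite expr0 (_ : diag_mx _ = 1%:M) ?mulmx1 ?mulVmx//.
    by apply/matrixP => a b; rewrite !mxE expr0.
  have -> : MC ^+ j.+1 = MC *m MC ^+ j by rewrite exprS.
  rewrite IH {1}MCE !mulmxA.
  rewrite (mulmxK Qu) -[_ *m diag_mx D *m _]mulmxA; congr (_ *m _ *m _).
  apply/matrixP => a b; rewrite mul_diag_mx !mxE exprS.
  by have [->|_] := eqVneq a b; rewrite ?mulr1n// ?mulr0n ?mulr0.
have perm : perm_eq [seq f a | a <- s] [seq D 0 i | i <- enum 'I_n].
  apply: prod_XsubC_eq; rewrite big_map [RHS]big_map big_enum /=.
  have := congr1 (map_poly f) Ms; rewrite map_char_poly -/MC {1}MCE.
  rewrite char_poly_conj// char_poly_trig ?diag_mx_is_trig// rmorph_prod /=.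
  under [X in _ = X]eq_bigr do rewrite map_polyXsubC.
  by move=> <-; apply: eq_bigr => i _; rewrite !mxE eqxx mulr1n.
apply: (fmorph_inj f); rewrite -trace_map_mx [RHS]rmorph_sum /=.
rewrite (_ : map_mx f _ = MC ^+ k); last first.
  elim: k {MCk} => [|k IH]; first by rewrite !expr0 map_mx1.
  by rewrite !exprS map_mxM -IH.
rewrite MCk mxtrace_mulC mulmxA mulmxV// mul1mx mxtrace_diag.
transitivity (\sum_(z <- [seq D 0 i | i <- enum 'I_n]) z ^+ k).
  by rewrite big_map big_enum /=; apply: eq_bigr => i _; rewrite mxE.
rewrite -(perm_big _ perm) big_map; apply: eq_bigr => a _.
by rewrite rmorphXn.
Qed.

Lemma spectrum_tail_bound (R : realType) n (M : 'M[R]_n) (s : n.-tuple R) m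
    (k : 'I_n) : M^T = M -> ordered_spectrum M s -> 1 \in (s : seq R) ->
  (0 < k)%N -> `|tnth s k| ^+ (m.*2) <= \tr (M ^+ m.*2) - 1.
Proof.
move=> MT sM s1 k0; rewrite (trace_exp_spectrum _ _ _ _ _ MT sM).
have n0 : (0 < n)%N by apply: leq_ltn_trans (ltn_ord k).
pose i0 := Ordinal n0.
have s0 : 1 <= tnth s i0.
  have [sorted_s _] := sM.
  have /(nthP 0)[i /=] := s1; rewrite size_tuple => ni <-.
  rewrite (tnth_nth 0) /=.
  apply: (sorted_leq_nth _ _ _ sorted_s) => //.
  - by move=> x y z /= yx zy; exact: le_trans zy yx.
  - by move=> x; exact: lexx.
  - by rewrite inE size_tuple.
  - by rewrite inE size_tuple.
have ev x : 0 <= x ^+ m.*2 :> R by rewrite -mul2n exprM exprn_ge0// sqr_ge0.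
rewrite big_tuple (bigD1 i0)//= (bigD1 k) /=; last by rewrite -val_eqE -lt0n.
rewrite -normrX (ger0_norm (ev _)).
have : 1 <= tnth s i0 ^+ m.*2 by rewrite exprn_ege1.
have : 0 <= \sum_(i < n | (i != i0) && (i != k)) tnth s i ^+ m.*2.
  by apply: sumr_ge0 => i _; exact: ev.
by lra.
Qed.

(** By convexity the left-hand side lies below its chord [1 + (2 ^ n - 1) * x] on [[0, 1]]. *)
Lemma expr1D_le (R : realFieldType) (x : R) n : 0 <= x <= 1 ->
  (1 + x) ^+ n <= 1 + 2 ^+ n * x.
Proof.
move=> /andP[x0 x1].
suff : (1 + x) ^+ n <= 1 + (2 ^+ n - 1) * x by move/le_trans; apply; lra.
elim: n => [|n IH]; first by rewrite !expr0; lra.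
rewrite exprSr; apply: (@le_trans _ _ ((1 + (2 ^+ n - 1) * x) * (1 + x))).
  by rewrite ler_wpM2r//; lra.
have p1 : 0 <= (2 ^+ n - 1 : R) by rewrite subr_ge0 exprn_ege1//; lra.
have : (2 ^+ n - 1) * x * x <= (2 ^+ n - 1) * x * 1 by rewrite ler_wpM2l// mulr_ge0.
by rewrite exprS; lra.
Qed.

Lemma expr_small (R : realType) (q e : R) : 0 <= q < 1 -> 0 < e ->
  exists2 m, (0 < m)%N & q ^+ m.*2 < e.
Proof.
move=> /andP[q0 q1] e0.
have [N _ hN] : \forall n \near \oo%classic, `|q ^+ n| < e.
  have := @cvg_expr R q; rewrite ger0_norm// => /(_ q1).
  by move/cvgr0Pnorm_lt; apply.
exists N.+1 => //; have := hN N.+1.*2; rewrite /= ger0_norm ?exprn_ge0//; apply.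
by rewrite -addnn addSn ltnW// ltnS leq_addr.
Qed.

(** The order of choices matters: [m] depends only on [r] and [d], then the tolerance [y] on [m],
    and the grid comes last. *)
Lemma grid_parameters (R : realType) (r : R) d : 1 < r < 2 ->
  exists m L (e : R), [/\ (0 < m)%N, (0 < grid_radius r L.+1)%N, 0 < e < 1 &
    ((1 + e) / (1 - e)) ^+ m.*2 *
      (\sum_a kpow (grid_walk r L.+1) m.*2 a a) ^+ d < 1 + (1 / 2) ^+ m.*2].
Proof.
move=> r12; pose s := (r - 1) * (2 - r) / 4; pose b := 1 / 2 - s.
have s0 : 0 < s by rewrite /s divr_gt0// mulr_gt0//; lra.
have s1 : s <= 1 / 4.
  have : (r - 1) * (2 - r) <= 1 * 1 by apply: ler_pM; lra.
  by rewrite /s; lra.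
have b0 : 0 < b by rewrite /b; lra.
have p2 j : 0 < 2 ^+ j :> R by rewrite exprn_gt0.
(* Equivalent to [2 ^ d * x < z / 2], where [x = 2 * b ^ (2m - 1)] is the excess over [1] in the
   bound on the one-dimensional trace. *)
have [m m0 hm] : exists2 m, (0 < m)%N & (2 * b) ^+ m.*2 < b / 2 ^+ d.+2.
  by apply: expr_small; [rewrite /b; lra|rewrite divr_gt0].
(* One factor [(1 + y) ^ (2m)] for the cell counts and one per coordinate for the grid. *)
pose K := (m.*2 * d.+1)%N; pose z : R := (1 / 2) ^+ m.*2.
have z0 : 0 < z by rewrite exprn_gt0.
have z1 : z <= 1 by rewrite exprn_ile1//; lra.
pose y := z / 4 / 2 ^+ K.
have y0 : 0 < y by rewrite !divr_gt0.
have y1 : y <= z / 4.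
  by rewrite ler_pdivrMr// ler_peMr ?exprn_ege1//; lra.
have [|L [g0 hL]] := trace_grid_walk_le r (1 + y) r12; first by lra.
(* This [e] solves [(1 + e) / (1 - e) = 1 + y]. *)
exists m, L, (y / (2 + y)).
have e0 : 0 < y / (2 + y) by rewrite divr_gt0//; lra.
have e1 : y / (2 + y) < 1 by rewrite ltr_pdivrMr; lra.
split => //; first by apply/andP.
have -> : (1 + y / (2 + y)) / (1 - y / (2 + y)) = 1 + y by field; lra.
have m2 : (m.*2 = m.*2.-1.+1)%N by rewrite prednK// double_gt0.
have := hL m.*2.-1; rewrite -m2 -/s -/b.
set x := 2 * b ^+ m.*2.-1 => hT.
have x0 : 0 <= x by rewrite mulr_ge0// exprn_ge0// ltW.
have xz : 2 ^+ d * x < z / 2.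
  have h : 4 * (2 ^+ d * b ^+ m.*2.-1 * 2 ^+ m.*2) < 1.
    move: hm; rewrite ltr_pdivlMr// exprMn {2}m2 (exprS b) !(exprS _ d.+1) !(exprS _ d).
    set B := b ^+ _; set Q := 2 ^+ m.*2; set E := 2 ^+ d => h.
    rewrite -(ltr_pM2l b0) mulr1; apply: le_lt_trans h.
    by rewrite le_eqVlt; apply/orP; left; apply/eqP; ring.
  rewrite /z expr_div_n expr1n mul1r -(ltr_pM2r (p2 m.*2)).
  rewrite [_ / 2 * _]mulrAC mulVf ?gt_eqF// /x.
  by rewrite mulrCA -mulrA; lra.
have x1 : x <= 1.
  have : 1 * x <= 2 ^+ d * x by rewrite ler_wpM2r// exprn_ege1//; lra.
  by lra.
have T0 : 0 <= \sum_a kpow (grid_walk r L.+1) m.*2 a a.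
  by apply: sumr_ge0 => a _; apply: kpow_ge0 => ? ?; exact: grid_walk_ge0.
apply: (@le_lt_trans _ _ ((1 + y) ^+ K * (1 + x) ^+ d)).
  rewrite /K mulnS exprD -mulrA ler_wpM2l ?exprn_ge0//; first by lra.
  rewrite exprM -exprMn; apply: lerXn2r => //; rewrite nnegrE// mulr_ge0 ?exprn_ge0//; lra.
apply: (@le_lt_trans _ _ ((1 + 2 ^+ K * y) * (1 + 2 ^+ d * x))).
  apply: ler_pM; rewrite ?exprn_ge0//; try lra; apply: expr1D_le; lra.
have -> : 2 ^+ K * y = z / 4 by rewrite /y mulrC divfK// gt_eqF.
have dx0 : 0 <= 2 ^+ d * x by rewrite mulr_ge0// ltW.
(* The product expands to less than [1 + z / 4 + z / 2 + z / 4]. *)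
rewrite -/z; have : z / 4 * (2 ^+ d * x) <= z / 4 * 1 by rewrite ler_wpM2l; lra.
lra.
Qed.

(** * The geometric graph *)

Section graph.
Context {R : realType} (d : nat) (r : R) (x : nat -> d.-tuple R).
Hypothesis r0 : 0 <= r.

Local Notation A n := (adjacency r x n).
Local Notation W n := (normalized_adjacency r x n).

Definition transition n (i j : 'I_n) : R := A n i j / degree r x i.

Lemma sup_dist_le (y z : d.-tuple R) :
  reflect (forall k, `|tnth y k - tnth z k| <= r) (sup_dist y z <= r).
Proof.
apply: (iffP (bigmax_leP _ _ _ _)) => [[_ h] k|h]; first exact: h.
by split.
Qed.

Lemma adjacencyE n i j :
  A n i j = [forall k, `|tnth (x i) k - tnth (x j) k| <= r]%:R.
Proof.
rewrite mxE /kernel_h; case: sup_dist_le => [h|nh].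
  by have -> : [forall k, `|tnth (x i) k - tnth (x j) k| <= r] by exact/forallP.
by case: forallP => // h; case: nh.
Qed.

Lemma adjacency_ge0 n i j : 0 <= A n i j.
Proof. by rewrite adjacencyE ler0n. Qed.

Lemma degree_gt0 n (i : 'I_n) : 0 < degree r x i.
Proof.
rewrite /degree (bigD1 i)//= ltr_wpDr//.
  by apply: sumr_ge0 => j _; exact: adjacency_ge0.
rewrite adjacencyE (_ : [forall k, _])//.
by apply/forallP => k; rewrite subrr normr0.
Qed.

Lemma normalized_adjacencyE n i j :
  W n i j = A n i j / (Num.sqrt (degree r x i) * Num.sqrt (degree r x j)).
Proof.
rewrite /normalized_adjacency /inv_sqrt_degrees -mulmxA mul_diag_mx mxE.
by rewrite mul_mx_diag !mxE invfM mulrCA mulrA.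
Qed.

(** Here [W = D^(1/2) (D^-1 A) D^(-1/2)]: the symmetric matrix is conjugate to the random walk on
    the graph. *)
Lemma kpow_normalized n k i j :
  kpow (W n) k i j =
  Num.sqrt (degree r x i) * kpow (@transition n) k i j / Num.sqrt (degree r x j).
Proof.
have s0 (a : 'I_n) : Num.sqrt (degree r x a) != 0.
  by rewrite gt_eqF// sqrtr_gt0 degree_gt0.
elim: k i j => [|k IH] i j /=.
  by have [->|_] := eqVneq i j; rewrite ?mulr0 ?mul0r// mulr1 divff.
rewrite mulr_sumr mulr_suml; apply: eq_bigr => l _.
rewrite IH normalized_adjacencyE /transition.
move: (s0 i) (sqr_sqrtr (ltW (degree_gt0 n i))); set si := Num.sqrt _ => si0 <-.
by field; rewrite si0 !s0.
Qed.

Lemma trace_normalized n k :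
  \tr (W n ^+ k) = \sum_i kpow (@transition n) k i i.
Proof.
apply: eq_bigr => i _; rewrite mx_kpow kpow_normalized mulrAC divff ?mul1r//.
by rewrite gt_eqF// sqrtr_gt0 degree_gt0.
Qed.

(** The square roots of the degrees form a left eigenvector, by symmetry of the adjacency matrix. *)
Lemma one_in_spectrum n (s : n.-tuple R) : (0 < n)%N ->
  ordered_spectrum (W n) s -> 1 \in (s : seq R).
Proof.
move=> n0 [_ Ws]; rewrite -root_prod_XsubC -Ws -eigenvalue_root_char.
pose v : 'rV[R]_n := \row_i Num.sqrt (degree r x i).
have s0 (a : 'I_n) : Num.sqrt (degree r x a) != 0.
  by rewrite gt_eqF// sqrtr_gt0 degree_gt0.
apply/eigenvalueP; exists v; last first.
  apply: contraTneq n0 => /matrixP v0; rewrite -leqNgt leqNgt.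
  by apply/negP => n0; have /eqP := v0 0 (Ordinal n0); rewrite !mxE (negPf (s0 _)).
rewrite scale1r; apply/rowP => j; rewrite !mxE.
transitivity (\sum_i A n j i / Num.sqrt (degree r x j)).
  apply: eq_bigr => i _; rewrite [v 0 i]mxE normalized_adjacencyE.
  have -> : A n j i = A n i j.
    by rewrite !mxE /kernel_h /sup_dist; under eq_bigr do rewrite distrC.
  by field; rewrite !s0.
rewrite -mulr_suml -/(degree r x j).
by rewrite -{1}(@sqr_sqrtr _ (degree r x j)) ?ltW ?degree_gt0// expr2 mulfK.
Qed.

End graph.

(** * Comparing the graph with the walk on cells *)

Definition cell_of {R : realType} d L (y : d.-tuple R) : {ffun 'I_d -> 'I_L.+1} :=
  [ffun k => inord (cell L.+1 (tnth y k))].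

Definition half_open_cube {R : realType} d : set (d.-tuple R) :=
  [set y | forall k, -1 <= tnth y k < 1]%classic.

(** A degree is at least [lo] times the number of cells within the inner radius, a product over
    coordinates, and adjacent points lie in cells within the outer radius. So [transition] is at
    most [lo^-1] times a product of [grid_walk] entries, and each cell holds at most [hi] points. *)
Lemma trace_normalized_le {R : realType} d (r : R) (x : nat -> d.-tuple R) n L
    (lo hi : R) :
  0 <= r -> (0 < grid_radius r L.+1)%N -> 0 < lo -> 0 <= hi ->
  (forall i, half_open_cube d (x i)) ->
  (forall c, lo <= #|[pred i : 'I_n | cell_of d L (x i) == c]|%:R <= hi) ->
  forall k, \tr (normalized_adjacency r x n ^+ k.+1) <=
    (hi / lo) ^+ k.+1 * (\sum_a kpow (grid_walk r L.+1) k.+1 a a) ^+ d.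
Proof.
move=> r0 g0 lo0 hi0 xcube cnt k.
have cellE i l : (cell_of d L (x i) l : nat) = cell L.+1 (tnth (x i) l).
  by rewrite ffunE inordK// cell_lt//; exact: xcube.
have x1 i l : -1 <= tnth (x i) l by case/andP: (xcube i l).
have := trace_kpow_prod 'I_d _ (grid_walk r L.+1) k.+1; rewrite card_ord => <-.
rewrite trace_normalized// [hi / lo]mulrC.
apply: (@trace_kpow_coarse_le _ _ _ (fun i : 'I_n => cell_of d L (x i))) => //.
- by rewrite invr_ge0 ltW.
- by move=> a b; apply: prodr_ge0 => l _; exact: grid_walk_ge0.
- move=> i j /=; have d0 := degree_gt0 d r x r0 n i.
  have a0 := adjacency_ge0 d r x r0 n i j.
  rewrite /transition divr_ge0 ?(ltW d0)//=.
  set ci := cell_of d L (x i); set cj := cell_of d L (x j).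
  pose D (c : {ffun 'I_d -> 'I_L.+1}) : R := \prod_l (near_deg L.+1 (grid_radius r
    L.+1).-1 (c l))%:R.
  have D0 : 0 < D ci by apply: prodr_gt0 => l _; rewrite ltr0n near_deg_gt0.
  have degD : lo * D ci <= degree r x i.
    rewrite /degree (partition_big (fun j : 'I_n => cell_of d L (x j)) predT)//=.
    have -> : D ci = \sum_c \prod_l (near_nat (grid_radius r L.+1).-1 (ci l)
        ((c : {ffun 'I_d -> 'I_L.+1}) l))%:R.
      by rewrite -(bigA_distr_bigA (fun l (b : 'I_L.+1) =>
        (near_nat (grid_radius r L.+1).-1 (ci l) b)%:R)); apply: eq_bigr => l _;
          rewrite sum_near.
    rewrite mulr_sumr; apply: ler_sum => c _.
    apply: (@le_trans _ _ (\sum_(j < n | cell_of d L (x j) == c)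
       \prod_l (near_nat (grid_radius r L.+1).-1 (ci l) (c l))%:R)).
      rewrite sumr_const -mulr_natl ler_wpM2r//; last by case/andP: (cnt c).
      by apply: prodr_ge0.
    apply: ler_sum => j' /eqP <-; rewrite adjacencyE//.
    case: forallP => [h|nh]; first by apply: prodr_ile1 => l; rewrite ler0n lern1 leq_b1.
    rewrite -natr_prod ler_nat leqNgt; apply/negP => h; apply: nh => l.
    apply: (cell_near r L.+1) => //.
    rewrite -!cellE; move: h; rewrite (bigD1 l)//=; by case: near_nat.
  rewrite [X in _ <= _ * X](_ : _ =
      (\prod_l (near_nat (grid_radius r L.+1).+1 (ci l) (cj l))%:R) / D ci); last first.
    by rewrite /D -prodf_div.
  rewrite mulrCA -invfM; apply: ler_pM => //.
  - by rewrite invr_ge0 ltW.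
  - rewrite adjacencyE//; case: forallP => [h|_]; last by apply: prodr_ge0.
    rewrite big1// => l _; rewrite !cellE near_cell//; exact: h.
  - by rewrite lef_pV2// posrE// mulr_gt0.
- by move=> c; case/andP: (cnt c).
Qed.

(** The deterministic half of the argument: the points enter only through the cell counts. *)
Lemma eigenvalue_lt_half {R : realType} d (r : R) : 1 < r < 2 ->
  exists L (e : R), 0 < e < 1 /\ forall (x : nat -> d.-tuple R) n,
  (forall i, half_open_cube d (x i)) ->
  (forall c, (1 - e) * (n%:R / L.+1%:R ^+ d) <=
     #|[pred i : 'I_n | cell_of d L (x i) == c]|%:R
     <= (1 + e) * (n%:R / L.+1%:R ^+ d)) ->
  forall k : 'I_n, (0 < k)%N ->
    `|tnth (eigenvalues (normalized_adjacency r x n)) k| < 1 / 2.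
Proof.
move=> r12; have [m [L [e [m0 g0 e01 H]]]] := grid_parameters _ r d r12.
exists L, e; split=> // x n xcube cnt k k0.
have r0 : 0 <= r by lra.
have n0 : (0 < n)%N by apply: leq_ltn_trans (ltn_ord k).
have W := normalized_adjacency_sym r x n.
have Ws := eigenvaluesP W.
have B := spectrum_tail_bound _ _ _ _ m k W Ws (one_in_spectrum _ _ _ r0 _ _ n0 Ws) k0.
set N := n%:R / L.+1%:R ^+ d in cnt.
have N0 : 0 < N by rewrite divr_gt0 ?ltr0n// exprn_gt0// ltr0n.
have lo0 : 0 < (1 - e) * N by rewrite mulr_gt0//; lra.
have hi0 : 0 <= (1 + e) * N by rewrite mulr_ge0// ?ltW//; lra.
have := trace_normalized_le _ _ _ _ _ _ _ r0 g0 lo0 hi0 xcube cnt m.*2.-1.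
(* The expected count [N] cancels from the ratio of the two bounds. *)
rewrite prednK ?double_gt0// -mulf_div divff ?gt_eqF// mulr1 => T.
have : `|tnth (eigenvalues (normalized_adjacency r x n)) k| ^+ m.*2 < (1 / 2) ^+ m.*2.
  by apply: le_lt_trans B _; rewrite ltrBlDl; exact: le_lt_trans T H.
by rewrite ltr_pXn2r// ?double_gt0// nnegrE.
Qed.

Local Open Scope classical_set_scope.
Local Open Scope ring_scope.

(** * Frequencies of independent events *)

Lemma measure_bigsetU_le disp (T : measurableType disp) (R : realType)
    (mu : measure T R) (I : Type) (s : seq I) (Q : pred I) (F : I -> set T) :
  (forall i, measurable (F i)) ->
  (mu (\big[setU/set0]_(i <- s | Q i) F i) <= \sum_(i <- s | Q i) mu (F i))%E.
Proof.
move=> mF; elim: s => [|i s IH]; first by rewrite !big_nil measure0.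
rewrite !big_cons; case: ifP => // _.
apply: le_trans (measureU2 _ _ _) _ => //; last by rewrite leeD2l.
by apply: bigsetU_measurable.
Qed.

Lemma Borel_Cantelli_geometric disp (T : measurableType disp) (R : realType)
    (mu : measure T R) (F : nat -> set T) (g : R) : 0 < g < 1 ->
  (forall n, measurable (F n)) -> (forall n, mu (F n) <= (g ^+ n)%:E)%E ->
  {ae mu, forall w, exists N, forall n, (N <= n)%N -> ~ F n w}.
Proof.
move=> /andP[g0 g1] mF Fg; exists (lim_sup_set F); split.
- by apply: bigcapT_measurable => n; apply: bigcup_measurable.
- apply: lim_sup_set_cvg0 => //.
  apply: (@le_lt_trans _ _ (1 / (1 - g))%:E); last exact: ltry.
  apply: lime_le; first by apply: is_cvg_nneseries => n _ _; exact: measure_ge0.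
  apply: nearW => n; apply: (@le_trans _ _ (\sum_(0 <= i < n) (g ^+ i)%:E)%E).
    by apply: lee_sum => i _; exact: Fg.
  rewrite sumEFin lee_fin.
  have := @geometric_le_lim R n 1 g ler01 g0; rewrite (ger0_norm (ltW g0)) => /(_ g1).
  apply: le_trans; rewrite /series /= le_eqVlt; apply/orP; left; apply/eqP.
  by apply: eq_bigr => i _; rewrite mul1r.
- move=> w /= nP n _ /=; apply: contrapT => h; apply: nP.
  by exists n => k nk Fk; apply: h; exists k.
Qed.

Section frequency.
Context disp (Omega : measurableType disp) disp' (T : measurableType disp')
  (R : realType) (P : probability Omega R) (X : nat -> {RV P >-> T}).
Hypothesis Xindep : independent_RVs X.

Definition hits (B : set T) n w : nat := #|[set i : 'I_n | X i w \in B]%SET|.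

Lemma measurable_hit i (B : set T) : measurable B -> measurable (X i @^-1` B).
Proof. by move=> mB; rewrite -[X in measurable X]setTI; exact: measurable_funP. Qed.

Variables (B : set T) (p : R).
Hypothesis mB : measurable B.
Hypothesis PB : forall i, P (X i @^-1` B) = p%:E.

Let pattern n (J : {set 'I_n}) : set Omega :=
  [set w | forall i : 'I_n, (X i w \in B) = (i \in J)].

(** The form that [independent_RVs] handles: at each index below [n], either [B] or its
    complement. *)
Lemma patternE n J : pattern n J =
  \bigcap_(i in [set` [fset k in iota 0 n]%fset])
    (X i @^-1` (if i \in [seq val j | j in J] then B else ~` B)).
Proof.
apply/seteqP; split=> w /= h.
  move=> i /=; rewrite in_fset mem_iota /= add0n => ni.
  have := h (Ordinal ni); rewrite /=.
  have -> : (i \in [seq val j | j in J]) = (Ordinal ni \in J).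
    exact: (fintype.mem_image val_inj _ (Ordinal ni)).
  by case: (_ \in J) => [/set_mem//|/negP hh] /mem_set.
move=> i; have := h i; rewrite /= in_fset mem_iota /= add0n ltn_ord => /(_ isT).
rewrite fintype.mem_image; last exact: val_inj.
case: (i \in J) => hi; first exact/mem_set.
by apply/negbTE/negP => /set_mem.
Qed.

Lemma measurable_pattern n J : measurable (pattern n J).
Proof.
rewrite patternE; apply: fin_bigcap_measurable; first exact: finite_fset.
by move=> i _; apply: measurable_hit; case: ifP => _ //; exact: measurableC.
Qed.

Lemma prob_pattern n J : P (pattern n J) =
  (\prod_(i < n) if i \in J then p else 1 - p)%:E.
Proof.
rewrite patternE.
have := Xindep [fset k in iota 0 n]%fset (fun i => if i \in [seq val j | j in J] then B
  else ~` B).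
move=> -> //; last by move=> i; case: ifP => _ //; exact: measurableC.
rewrite (perm_big (index_iota 0 n)) /=; last first.
  apply: uniq_perm; [exact: fset_uniq|exact: iota_uniq|].
  by move=> i; rewrite in_fset /index_iota subn0.
rewrite big_mkord.
rewrite (eq_bigr (fun i : 'I_n => (if i \in J then p else 1 - p)%:E)) ?prodEFin//.
move=> i _; rewrite fintype.mem_image; last exact: val_inj.
case: ifP => // _.
by rewrite preimage_setC probability_setC ?PB//; exact: measurable_hit.
Qed.

(** Chernoff bound for the lower tail: too few hits among [n] points has probability at most [g ^ n]
    with [g < 1], and Borel-Cantelli applies. *)
Lemma hits_ge q : q < p ->
  {ae P, forall w, exists N, forall n, (N <= n)%N -> q * n%:R <= (hits B n w)%:R}.
Proof.
move=> qp; have [q0|q0] := leP q 0.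
  apply: aeW => w; exists 0%N => n _; apply: (@le_trans _ _ 0) => //.
  by rewrite mulr_le0_ge0.
have p0 : 0 < p by exact: lt_trans qp.
have p1 : p <= 1 by rewrite -lee_fin -(PB 0) probability_le1//; exact: measurable_hit.
(* Chosen so that [(1 + t) * q] is the midpoint of [q] and [p]. *)
pose t := (p - q) / (2 * q).
have t0 : 0 < t by rewrite divr_gt0//; lra.
have tqp : (1 + t) * q < p.
  have -> : (1 + t) * q = q + (p - q) / 2 by rewrite /t; field; rewrite gt_eqF.
  lra.
pose z := expR (- t).
have z0 : 0 < z by exact: expR_gt0.
have zt : z * (1 + t) <= 1.
  by rewrite /z expRN ler_pdivrMl ?expR_gt0// mulr1 expR_ge1Dx.
(* The mean of [exp (t * (q - 1_B))]. From [z <= 1 / (1 + t)] follows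
   [g <= exp (t * q - p * t / (1 + t)) < 1]. *)
pose g := expR (t * q) * (z * p + (1 - p)).
have g0 : 0 < g by rewrite mulr_gt0 ?expR_gt0// ltr_pwDl ?mulr_gt0//; lra.
have g1 : g < 1.
  apply: (@le_lt_trans _ _ (expR (t * q) * expR (- (p * (1 - z))))).
    rewrite ler_wpM2l ?expR_ge0//; apply: le_trans (expR_ge1Dx _); lra.
  rewrite -expRD -[X in _ < X]expR0 ltr_expR subr_lt0.
  have h1 : t * (1 + t) * q < t * p by rewrite -mulrA ltr_pM2l.
  have h2 : p * (z * (1 + t)) <= p * 1 by rewrite ler_wpM2l// ltW.
  have t1 : 0 < 1 + t by lra.
  rewrite -(ltr_pM2r t1). lra.
pose F n := \big[setU/set0]_(J : {set 'I_n} | #|J|%:R < q * n%:R) pattern n J.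
have mF n : measurable (F n).
  by apply: bigsetU_measurable => J _; exact: measurable_pattern.
have PF n : (P (F n) <= (g ^+ n)%:E)%E.
  apply: (@le_trans _ _ _ _ _ (measure_bigsetU_le _ _ _ _ _ _ _ _ _)).
    by move=> J; exact: measurable_pattern.
  rewrite (eq_bigr (fun J : {set 'I_n} =>
      (\prod_(i < n) if i \in J then p else 1 - p)%:E)); last first.
    by move=> J _; exact: prob_pattern.
  rewrite sumEFin lee_fin /g exprMn.
  have -> : (z * p + (1 - p)) ^+ n =
      \sum_(J : {set 'I_n}) \prod_(i < n) (if i \in J then z * p else 1 - p).
    by rewrite -bigA_distr prodr_const card_ord.
  rewrite mulr_sumr big_mkcond /=; apply: ler_sum => J _.
  have q1 : 0 <= 1 - p by lra.
  have E : \prod_(i < n) (if i \in J then z * p else 1 - p) =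
      z ^+ #|J| * \prod_(i < n) (if i \in J then p else 1 - p).
    rewrite -prodr_const [X in _ = X * _]big_mkcond -big_split; apply: eq_bigr => i _ /=.
    by case: ifP; rewrite ?mul1r.
  have Z0 : 0 <= \prod_(i < n) (if i \in J then p else 1 - p).
    by apply: prodr_ge0 => i _; case: ifP => _ //; exact: ltW.
  rewrite E mulrA; case: ifP => [Jq|_]; last first.
    by rewrite !mulr_ge0// exprn_ge0// ?expR_ge0// ltW.
  (* The tilting factor [exp (t * (q * n - #|J|))] is at least [1] on patterns with too few hits. *)
  rewrite ler_peMl// /z -!expRM_natr -expRD -[X in X <= _]expR0 ler_expR.
  have : 0 <= t * (q * n%:R - #|J|%:R) by rewrite mulr_ge0// ltW// subr_gt0.
  lra.
have g01 : 0 < g < 1 by rewrite g0.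
apply: filterS (Borel_Cantelli_geometric _ _ _ _ _ _ g01 mF PF) => w [N hN].
exists N => n Nn; have := hN n Nn; apply: contra_notT; rewrite -ltNge => hq.
rewrite /F -bigcup_seq_cond.
exists [set i : 'I_n | X i w \in B]%SET; first by rewrite /= mem_index_enum.
by move=> i /=; rewrite inE.
Qed.
End frequency.
Arguments hits {disp Omega disp' T R P} X B n w.
Arguments measurable_hit {disp Omega disp' T R P} X i {B}.
Arguments hits_ge {disp Omega disp' T R P X} Xindep {B p} mB PB {q}.

(** Apply the lower bound to the complement of [B], of probability [1 - p]: the two counts add up to
    [n]. *)
Lemma hits_le disp (Omega : measurableType disp) disp' (T : measurableType disp')
  (R : realType) (P : probability Omega R) (X : nat -> {RV P >-> T})
  (Xindep : independent_RVs X) (B : set T) (p : R) (mB : measurable B)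
  (PB : forall i, P (X i @^-1` B) = p%:E) (q : R) : p < q ->
  {ae P, forall w, exists N, forall n, (N <= n)%N ->
     (hits X B n w)%:R <= q * n%:R}.
Proof.
move=> pq.
have PC i : P (X i @^-1` ~` B) = (1 - p)%:E.
  by rewrite preimage_setC probability_setC ?PB//; exact: (measurable_hit X i mB).
have qp : 1 - q < 1 - p by lra.
apply: filterS (hits_ge Xindep (measurableC mB) PC qp).
move=> w [N hN]; exists N => n /hN; rewrite /hits.
have -> : [set i : 'I_n | X i w \in ~` B]%SET = (~: [set i : 'I_n | X i w \in B])%SET.
  by apply/setP => i; rewrite !inE in_setC.
have := cardsC [set i : 'I_n | X i w \in B]%SET.
move=> /(congr1 (fun k => k%:R : R)); rewrite card_ord natrD; lra.
Qed.

(** * Volumes of boxes and uniform points *)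

Section volume.
Context {R : realType}.

Definition box d (a b : 'I_d -> R) : set (d.-tuple R) :=
  [set y | forall k, a k <= tnth y k < b k].

Lemma measurable_box d (a b : 'I_d -> R) : measurable (box d a b).
Proof.
have -> : box d a b = \bigcap_(k in [set: 'I_d]) ((@tnth d R)^~ k @^-1` `[a k, b k[).
  apply/seteqP; split=> y /= h k; first by move=> _; rewrite /= in_itv /=.
  by have := h k I; rewrite /= in_itv.
apply: fin_bigcap_measurable => // k _.
by rewrite -[X in measurable X]setTI; apply: measurable_tnth.
Qed.

Lemma volume_set0 d : volume (set0 : set (d.-tuple R)) = 0%E.
Proof.
elim: d => [|d IH] /=; first by rewrite diracE in_set0.
by rewrite -[RHS](integral0 lebesgue_measure setT); apply: eq_integral => x _; exact: IH.
Qed.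

(** By induction on [d]: the slice at [x] is the remaining box if [x] lies in the first interval and
    is empty otherwise. *)
Lemma volume_box d (a b : 'I_d -> R) : (forall k, a k <= b k) ->
  volume (box d a b) = (\prod_k (b k - a k))%:E.
Proof.
elim: d a b => [|d IH] a b ab.
  rewrite /= diracE big_ord0 mem_set//; by case.
rewrite /= big_ord_recl.
pose V := \prod_(k < d) (b (lift ord0 k) - a (lift ord0 k)).
pose I := `[a ord0, b ord0[%classic : set R.
have slice x : volume [set t : d.-tuple R | box d.+1 a b [tuple of x :: t]] =
    (V * \1_I x)%:E.
  rewrite indicE; have [xI|xI] := boolP (x \in I).
    rewrite mulr1 -IH; last by move=> k; exact: ab.
    congr volume; apply/seteqP; split=> t /= h k.
      by have := h (lift ord0 k); rewrite tnthS.
    case: (unliftP ord0 k) => [j ->|->]; first by rewrite tnthS; exact: h.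
    by rewrite tnth0; move/set_mem : xI; rewrite /I /= in_itv.
  rewrite mulr0 -[RHS](volume_set0 d); congr volume; apply/seteqP; split=> t //= h.
  move/negP : xI; apply; apply/mem_set; rewrite /I /= in_itv /=.
  by have := h ord0; rewrite tnth0.
under eq_integral do rewrite slice.
have V0 : 0 <= V by apply: prodr_ge0 => k _; rewrite subr_ge0.
rewrite (@integralZl_indic _ _ _ lebesgue_measure setT measurableT (fun=> I) V);
  last 2 first.
- by rewrite ltNge V0.
- exact: measurable_itv.
rewrite integral_indic//; last exact: measurable_itv.
have muI := lebesgue_measure_itv `[a ord0, b ord0[.
rewrite setIT; apply: (etrans (congr1 (mule V%:E) muI)).
rewrite /= lte_fin; have := ab ord0; rewrite le_eqVlt => /predU1P[->|->].
  by rewrite ltxx mule0 subrr mul0r.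
by rewrite -EFinB -EFinM mulrC.
Qed.

End volume.

(** Rescaling by [(L + 1) / 2] turns the bounds of the box into those that characterize the
    truncation in [cell]. *)
Lemma cell_box d L (c : {ffun 'I_d -> 'I_L.+1}) (R : realType) (y : d.-tuple R) :
  half_open_cube d y -> (cell_of d L y == c) =
  (y \in box d (fun k => -1 + 2 * (c k)%:R / L.+1%:R)
                (fun k => -1 + 2 * (c k).+1%:R / L.+1%:R)).
Proof.
move=> ycube; have L0 : 0 < L.+1%:R :> R by rewrite ltr0n.
have cl k : (cell_of d L y k : nat) = cell L.+1 (tnth y k).
  by rewrite ffunE inordK// cell_lt//; exact: ycube.
have yk k : -1 <= tnth y k by case/andP: (ycube k).
have E k (j : nat) : (-1 + 2 * j%:R / L.+1%:R <= tnth y k) =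
    (j%:R <= (tnth y k + 1) / 2 * L.+1%:R).
  rewrite -subr_ge0 -[RHS]subr_ge0.
  have -> : (tnth y k + 1) / 2 * L.+1%:R - j%:R =
    (tnth y k - (-1 + 2 * j%:R / L.+1%:R)) * (L.+1%:R / 2) by field; rewrite gt_eqF.
  by rewrite pmulr_lge0// divr_gt0.
apply/eqP/idP => [<-|/set_mem yB].
  apply/mem_set => k; rewrite E ltNge E -ltNge cl.
  exact: cell_itv.
apply/ffunP => k; apply/val_inj; rewrite /= cl.
have := yB k; rewrite E ltNge E -ltNge => /truncn_def; exact.
Qed.

Section uniform_points.
Context (R : realType) (disp : measure_display) (Omega : measurableType disp)
  (P : probability Omega R) (d : nat).

Lemma uniform_box (X : {RV P >-> d.-tuple R}) (a b : 'I_d -> R) :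
  uniform_on_cube X -> (forall k, -1 <= a k) -> (forall k, a k <= b k) ->
  (forall k, b k <= 1) ->
  P (X @^-1` box d a b) = (\prod_k ((b k - a k) / 2))%:E.
Proof.
move=> Xunif a1 ab b1; have := Xunif _ (measurable_box d a b).
rewrite /distribution /pushforward => ->.
rewrite setIidl ?volume_box//; last first.
  move=> y yB k; have /andP[h1 h2] := yB k.
  by rewrite (le_trans (a1 k) h1) (le_trans (ltW h2) (b1 k)).
rewrite -EFinM; congr EFin.
have -> : 2 ^- d = \prod_(k < d) (2^-1 : R) by rewrite prodr_const card_ord exprVn.
by rewrite -big_split; apply: eq_bigr => k _; rewrite mulrC.
Qed.

Lemma ae_half_open_cube (X : {RV P >-> d.-tuple R}) : uniform_on_cube X ->
  {ae P, forall w, half_open_cube d (X w)}.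
Proof.
move=> Xunif; have mB := measurable_box d (fun=> -1 : R) (fun=> 1).
exists (X @^-1` (~` box d (fun=> -1) (fun=> 1))); split.
- rewrite -[X in measurable X]setTI.
  by apply: measurable_funP => //; exact: measurableC.
- rewrite -preimage_setC probability_setC; last first.
    by rewrite -[X in measurable X]setTI; exact: measurable_funP.
  rewrite (uniform_box _ _ _ Xunif)//=; try by move=> _; lra.
  by rewrite big1 ?subee// => k _; field.
- by move=> w.
Qed.

End uniform_points.

(** * From almost sure cell frequencies to eigenvalues *)

Theorem theorem2p3 (R : realType) (disp : measure_display)
    (Omega : measurableType disp) (P : probability Omega R)
    (d : nat) (r : R) (X : nat -> {RV P >-> d.-tuple R})
    (hd : (1 <= d)%N) (hr : 1 < r < 2)
    (Xindep : independent_RVs X)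
    (Xunif : forall i, uniform_on_cube (X i)) :
  {ae P, forall w, exists N : nat, (0 < N)%N /\
    forall n : nat, (N <= n)%N ->
    forall k : 'I_n, (0 < k)%N ->
      `|tnth (eigenvalues (normalized_adjacency r (fun i => X i w) n)) k|
        < 1 / 2}.
Proof.
have [L [e [/andP[e0 e1] H]]] := eigenvalue_lt_half d r hr.
(* The share of one cell in the volume of the cube. *)
pose p : R := (L.+1%:R ^+ d)^-1.
have p0 : 0 < p by rewrite invr_gt0 exprn_gt0// ltr0n.
pose B (c : {ffun 'I_d -> 'I_L.+1}) : set (d.-tuple R) :=
  box d (fun k => -1 + 2 * (c k)%:R / L.+1%:R) (fun k => -1 + 2 * (c k).+1%:R / L.+1%:R).
have mB c : measurable (B c) by exact: measurable_box.
have PB c i : P (X i @^-1` B c) = p%:E.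
  have L0 : 0 < L.+1%:R :> R by rewrite ltr0n.
  rewrite (uniform_box _ _ _ _ _ _ _ _ (Xunif i)).
  - congr EFin; rewrite /p -exprVn -[in RHS](card_ord d) -prodr_const.
    apply: eq_bigr => k _; rewrite -natr1; field; rewrite gt_eqF//.
  - by move=> k; rewrite lerDl divr_ge0// ?mulr_ge0.
  - by move=> k; rewrite lerD2l ler_wpM2r ?invr_ge0 ?ler_wpM2l ?ler_nat ?ltW.
  - move=> k; have : (c k).+1%:R / L.+1%:R <= 1 :> R.
      by rewrite ler_pdivrMr// mul1r ler_nat.
    by rewrite -mulrA; move: (_ / _) => u ?; lra.
have cube : {ae P, forall w, forall i, half_open_cube d (X i w)}.
  by apply: ae_foralln => i; exact: ae_half_open_cube.
have freq c : {ae P, forall w, exists N, forall n, (N <= n)%N ->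
    (1 - e) * p * n%:R <= (hits X (B c) n w)%:R <= (1 + e) * p * n%:R}.
  have lo : (1 - e) * p < p by rewrite gtr_pMl//; lra.
  have hi : p < (1 + e) * p by rewrite ltr_pMl//; lra.
  have := hits_ge Xindep (mB c) (PB c) lo.
  apply: filterS2 (hits_le _ _ _ _ _ _ _ Xindep _ _ (mB c) (PB c) _ hi).
  move=> w [N hN] [N' hN']; exists (maxn N N') => n.
  by rewrite geq_max => /andP[/hN -> /hN' ->].
(* There are finitely many cells, so one null set serves them all. *)
have freqs : {ae P, forall w, forall c, exists N, forall n, (N <= n)%N ->
    (1 - e) * p * n%:R <= (hits X (B c) n w)%:R <= (1 + e) * p * n%:R}.
  exact: filter_forall.
apply: filterS2 cube freqs => w wcube /choice[N hN].
(* The successor makes the threshold positive. *)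
exists (\max_c N c).+1; split => // n nN.
apply: H => // c.
have cn : (N c <= n)%N by apply: leq_trans (ltnW nN); exact: leq_bigmax.
have := hN c n cn; rewrite /hits cardsE.
have -> : #|[pred i : 'I_n | X i w \in B c]| =
          #|[pred i : 'I_n | cell_of d L (X i w) == c]|.
  by apply: eq_card => i; rewrite !inE cell_box.
by rewrite -!mulrA [p * _]mulrC.
Qed.
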